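(* Let $S$ be a $J$-frame operator in the Krein space $(\mathcal H,[\cdot,\cdot])$. (i) Suppose that $\mathcal H=\mathcal H_+\,[\dotplus]\,\mathcal H_-$ is a fundamental decomposition with respect to which $$S=\begin{bmatrix} A & -AK\\ K^*A & D\end{bmatrix},$$ where $A$ is uniformly positive in the Hilbert space $(\mathcal H_+,[\cdot,\cdot])$, $K:\mathcal H_-\to\mathcal H_+$ satisfies $\|K\|<1$, and $D$ is self-adjoint with $D+K^*AK$ uniformly positive in the Hilbert space $(\mathcal H_-,-[\cdot,\cdot])$. Assume that $\overline{W(A)}=[a_-,a_+]$, $\overline{W(D)}=[d_-,d_+]$ and $\overline{W(D+K^*AK)}=[b_-,b_+]$. Then $$\sigma(S)\setminus\mathbb R\subseteq\Bigl\{\lambda\in\mathbb C:\ |\lambda-a_+|<a_+\ \text{and}\ \operatorname{Re}\lambda>\frac{b_-}{2}\Bigr\},$$ $$\sigma(S)\cap\mathbb R\subseteq\bigl[\min\{a_-,b_-\},\max\{a_+,d_+\}\bigr].$$ (ii) Suppose that $\mathcal H=\mathcal K_+\,[\dotplus]\,\mathcal K_-$ is a fundamental decomposition with respect to which $$S=\begin{bmatrix} A' & LD'\\ -D'L^* & D'\end{bmatrix},$$ where $A'$ is self-adjoint with $A'+LD'L^*$ uniformly positive in the Hilbert space $(\mathcal K_+,[\cdot,\cdot])$, $L:\mathcal K_-\to\mathcal K_+$ satisfies $\|L\|<1$, and $D'$ is uniformly positive in the Hilbert space $(\mathcal K_-,-[\cdot,\cdot])$. Assume that $\overline{W(A')}=[a'_-,a'_+]$,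 $\overline{W(D')}=[d'_-,d'_+]$ and $\overline{W(A'+LD'L^* )}=[b'_-,b'_+]$. Then $$\sigma(S)\setminus\mathbb R\subseteq\Bigl\{\lambda\in\mathbb C:\ |\lambda-d'_+|<d'_+\ \text{and}\ \operatorname{Re}\lambda>\frac{b'_-}{2}\Bigr\},$$ $$\sigma(S)\cap\mathbb R\subseteq\bigl[\min\{d'_-,b'_-\},\max\{a'_+,d'_+\}\bigr].$$
   Context: Krein spaces (over $\mathbb C$). A Krein space $(\mathcal H,[\cdot,\cdot])$ is a vector space with a Hermitian sesquilinear form admitting a fundamental decomposition $\mathcal H=\mathcal H_+\,[\dotplus]\,\mathcal H_-$, i.e. a direct, $[\cdot,\cdot]$-orthogonal sum such that $(\mathcal H_+,[\cdot,\cdot])$ and $(\mathcal H_-,-[\cdot,\cdot])$ are Hilbert spaces. The associated Hilbert inner product is $\langle x_++x_-,y_++y_-\rangle=[x_+,y_+]-[x_-,y_-]$; the norms coming from different fundamental decompositions are equivalent, so the topology of $\mathcal H$ is independent of the choice. A subspace $\mathcal L$ is uniformly positive (negative) if there is $\alpha>0$ with $[x,x]\ge\alpha\|x\|^2$ (resp. $-[x,x]\ge\alpha\|x\|^2$) for all $x\in\mathcal L$; maximal means maximal with respect to inclusion among such subspaces. $J$-frames. A family $\mathcal F=\{f_i\}_{i\in I}$ in $\mathcal H$ is a Bessel family if $\sum_{i\in I}|\langle f,f_i\rangle|^2\le\beta\|f\|^2$ for all $f$, for some $\beta<\infty$. Its synthesis operator is the bounded operator $T:\ell_2(I)\to\mathcal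 H$, $Tx=\sum_{i\in I}x_if_i$. Put $I_+=\{i:[f_i,f_i]\ge0\}$, $I_-=\{i:[f_i,f_i]<0\}$, and $T_\pm x=\sum_{i\in I_\pm}x_if_i$. $\mathcal F$ is a $J$-frame for $\mathcal H$ if the range $R(T_+)$ is a maximal uniformly positive subspace and $R(T_-)$ is a maximal uniformly negative subspace of $\mathcal H$. The $J$-frame operator of $\mathcal F$ is $Sf=\sum_{i\in I_+}[f,f_i]f_i-\sum_{i\in I_-}[f,f_i]f_i$. An operator $S$ is called a $J$-frame operator if it is the $J$-frame operator of some $J$-frame for $\mathcal H$; it is bounded, boundedly invertible and self-adjoint in the Krein space. Operators. Block operator matrices act on $x_++x_-$ as column vectors and have bounded entries. Adjoints $K^*$, $L^*$, norms $\|K\|,\|L\|$, self-adjointness of the entries, and numerical ranges $W(\cdot)$ (the set of values $\langle Bg,g\rangle$, $\|g\|=1$) are taken with respect to the Hilbert spaces $(\mathcal H_+,[\cdot,\cdot])$, $(\mathcal H_-,-[\cdot,\cdot])$ (resp. $(\mathcal K_+,[\cdot,\cdot])$, $(\mathcal K_-,-[\cdot,\cdot])$). A bounded self-adjoint operator in a Hilbert space is uniformly positive if it is positive-definite and boundedly invertible. $\sigma(S)$ is the spectrum of $S$. *)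

(* Defs.v *)
From HB Require Import structures.
From mathcomp Require Import all_boot all_order all_algebra finmap.
From mathcomp Require Import sesquilinear complex.
From mathcomp Require Import all_classical all_reals all_analysis.
From mathcomp.analysis.showcase Require Import summability.

Set Implicit Arguments.
Unset Strict Implicit.
Unset Printing Implicit Defensive.

Import Order.TTheory GRing.Theory Num.Theory.
Import numFieldNormedType.Exports.

Local Open Scope classical_set_scope.
Local Open Scope complex_scope.
Local Open Scope ring_scope.

(* Hermitian forms are linear in the first argument and conjugate-linear in
   the second one. *)
Notation hermitian_form V := {hermitian_sym V for Num.conj}.

Section LinearSubspaces.
Context {K : fieldType} {V : lmodType K}.

Record subspace_of (U : submodClosed V) : Type :=
  SubspaceOf { subspace_val :> V; subspace_valP : subspace_val \in U }.

Context (U : submodClosed V).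

HB.instance Definition _ := [isSub for @subspace_val U].
HB.instance Definition _ := [Choice of subspace_of U by <:].
HB.instance Definition _ := [SubChoice_isSubLmodule of subspace_of U by <:].

End LinearSubspaces.

Section Forms.
Context {R : realType} {V : lmodType R[i]}.

Definition opp_form (f : V -> V -> R[i]) (x y : V) : R[i] := - f x y.

Definition restrict_form (f : V -> V -> R[i]) (U : submodClosed V)
  (x y : subspace_of U) : R[i] := f (val x) (val y).
Arguments restrict_form : clear implicits.

Context (f : hermitian_form V).

Fact opp_form_linearl y : linear_for *%R ((opp_form f)^~ y).
Proof. by move=> a u v; rewrite /opp_form linearPl opprD mulrN. Qed.

Fact opp_form_linearr x : linear_for (Num.conj \; *%R) (opp_form f x).
Proof. by move=> a u v; rewrite /opp_form linearPr /= opprD mulrN. Qed.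

HB.instance Definition _ := bilinear_isBilinear.Build R[i] V V R[i] *%R
  (Num.conj \; *%R) (opp_form f) (opp_form_linearl, opp_form_linearr).

Fact opp_form_hermitian x y :
  opp_form f x y = (-1) ^+ false * Num.conj (opp_form f y x).
Proof. by rewrite /opp_form expr0 mul1r rmorphN hermC /= expr0 mul1r. Qed.

HB.instance Definition _ := isHermitianSesquilinear.Build R[i] V false Num.conj
  (opp_form f) opp_form_hermitian.

Context (U : submodClosed V).

Fact restrict_form_linearl y : linear_for *%R ((restrict_form f U)^~ y).
Proof. by move=> a u v; rewrite /restrict_form linearP linearPl. Qed.

Fact restrict_form_linearr x :
  linear_for (Num.conj \; *%R) (restrict_form f U x).
Proof. by move=> a u v; rewrite /restrict_form [val (_ + _)]linearP linearPr. Qed.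

HB.instance Definition _ := bilinear_isBilinear.Build R[i] (subspace_of U)
  (subspace_of U) R[i] *%R (Num.conj \; *%R) (restrict_form f U)
  (restrict_form_linearl, restrict_form_linearr).

Fact restrict_form_hermitian x y :
  restrict_form f U x y = (-1) ^+ false * Num.conj (restrict_form f U y x).
Proof. by rewrite /restrict_form hermC. Qed.

HB.instance Definition _ := isHermitianSesquilinear.Build R[i] (subspace_of U)
  false Num.conj (restrict_form f U) restrict_form_hermitian.

End Forms.
Arguments restrict_form {R V} f U x y : rename.

(* Below, [ip] stands for the inner product of a Hilbert space; the norm of
   [x] is the real number sqrt <x, x>. *)
Section Hilbert.
Context {R : realType} {V : lmodType R[i]}.
Implicit Types ip : hermitian_form V.

Definition ipnorm ip (x : V) : R := Num.sqrt (complex.Re (ip x x)).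

Definition positive_definite_form ip := forall x, x != 0 -> 0 < ip x x.

Definition ip_complete ip := forall u : nat -> V,
  (forall e : R, 0 < e -> exists N : nat, forall m n : nat,
     (N <= m)%N -> (N <= n)%N -> ipnorm ip (u m - u n) < e) ->
  exists l : V, ipnorm ip (u n - l) @[n --> \oo] --> (0 : R).

Definition hilbert_space ip := positive_definite_form ip /\ ip_complete ip.

End Hilbert.

Section Operators.
Context {R : realType} {V W : lmodType R[i]}.
Implicit Types (ipV : hermitian_form V) (ipW : hermitian_form W) (T : V -> W).

Definition bounded_operator ipV ipW T :=
  exists M : R, forall x, ipnorm ipW (T x) <= M * ipnorm ipV x.

Definition operator_norm ipV ipW T : R :=
  sup [set ipnorm ipW (T x) | x in [set x | ipnorm ipV x <= 1]].

Definition is_adjoint ipV ipW T (T' : W -> V) :=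
  forall x y, ipW (T x) y = ipV x (T' y).

End Operators.

Section Endomorphisms.
Context {R : realType} {V : lmodType R[i]}.
Implicit Types ip : hermitian_form V.

Definition self_adjoint ip (T : V -> V) := is_adjoint ip ip T T.

Definition boundedly_invertible ip (T : V -> V) := exists T' : V -> V,
  [/\ cancel T T', cancel T' T & bounded_operator ip ip T'].

Definition uniformly_positive_operator ip (T : V -> V) :=
  [/\ bounded_operator ip ip T, self_adjoint ip T,
      (forall x, x != 0 -> 0 < ip (T x) x) & boundedly_invertible ip T].

(* [R[i]^o] only serves to select the usual topology of the complex plane. *)
Definition numerical_range ip (T : V -> V) : set R[i]^o :=
  [set ip (T g) g | g in [set g | ipnorm ip g = 1]].

Definition spectrum ip (T : V -> V) : set R[i] :=
  [set l | ~ boundedly_invertible ip (fun x => T x - l *: x)].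

End Endomorphisms.

Section ComplexSets.
Context {R : realType}.

Definition complex_segment (a b : R) : set R[i] :=
  [set x%:C | x in `[a, b]].

Definition real_line : set R[i] := range (real_complex R).

End ComplexSets.

Section Krein.
Context {R : realType} {H : lmodType R[i]} (f : hermitian_form H).

Record fundamental_decomposition := FundamentalDecomposition {
  fd_plus : submodClosed H;
  fd_minus : submodClosed H;
  fd_sum : forall x, exists (xp : subspace_of fd_plus)
    (xm : subspace_of fd_minus), x = val xp + val xm;
  fd_direct : forall x, x \in fd_plus -> x \in fd_minus -> x = 0;
  fd_orthogonal : forall (xp : subspace_of fd_plus)
    (xm : subspace_of fd_minus), f (val xp) (val xm) = 0;
  fd_plus_hilbert : hilbert_space (restrict_form f fd_plus);
  fd_minus_hilbert : hilbert_space (opp_form (restrict_form f fd_minus))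
}.

Definition krein_space := inhabited fundamental_decomposition.

Context (E : fundamental_decomposition).

Definition Hplus : lmodType R[i] := subspace_of (fd_plus E).
Definition Hminus : lmodType R[i] := subspace_of (fd_minus E).

Definition ip_plus : hermitian_form Hplus := restrict_form f (fd_plus E).
Definition ip_minus : hermitian_form Hminus :=
  opp_form (restrict_form f (fd_minus E)).

(* Components of a vector; [xget] picks the unique element of the set. *)
Definition proj_plus (x : H) : Hplus :=
  xget 0 [set xp | exists xm : Hminus, x = val xp + val xm].
Definition proj_minus (x : H) : Hminus :=
  xget 0 [set xm | exists xp : Hplus, x = val xp + val xm].

Lemma fd_unique (xp yp : Hplus) (xm ym : Hminus) :
  val xp + val xm = val yp + val ym -> xp = yp /\ xm = ym.
Proof.
move=> e.
have e' : val (xp - yp) = val (ym - xm).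
  rewrite !raddfB /=; apply/eqP.
  by rewrite subr_eq addrAC -[X in _ == X + _]addrC -e addrK.
have z : val (xp - yp) = 0.
  apply: (@fd_direct E).
    exact: subspace_valP.
  by rewrite e' subspace_valP.
split; first by apply/eqP; rewrite -subr_eq0; apply/eqP/val_inj; rewrite z.
by apply/esym/eqP; rewrite -subr_eq0; apply/eqP/val_inj; rewrite -e' z.
Qed.

Lemma proj_sum (x : H) : x = val (proj_plus x) + val (proj_minus x).
Proof.
have [xp [xm e]] := fd_sum E x.
suff [-> ->] : proj_plus x = xp /\ proj_minus x = xm by [].
split; apply: xget_unique; rewrite /=.
- by exists xm.
- by move=> yp [ym]; rewrite e => /fd_unique[].
- by exists xp.
- by move=> ym [yp]; rewrite e => /fd_unique[].
Qed.

Lemma projP (xp : Hplus) (xm : Hminus) (x : H) :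
  x = val xp + val xm -> proj_plus x = xp /\ proj_minus x = xm.
Proof. by move=> e; apply: fd_unique; rewrite -proj_sum. Qed.

Fact proj_linear a u v :
  proj_plus (a *: u + v) = a *: proj_plus u + proj_plus v /\
  proj_minus (a *: u + v) = a *: proj_minus u + proj_minus v.
Proof.
apply: projP; rewrite !linearP {1}(proj_sum u) {1}(proj_sum v).
by rewrite scalerDr addrACA.
Qed.

HB.instance Definition _ := GRing.isLinear.Build R[i] H Hplus *:%R proj_plus
  (fun a u v => (proj_linear a u v).1).
HB.instance Definition _ := GRing.isLinear.Build R[i] H Hminus *:%R proj_minus
  (fun a u v => (proj_linear a u v).2).

Definition hilbert_ip (x y : H) : R[i] :=
  ip_plus (proj_plus x) (proj_plus y) + ip_minus (proj_minus x) (proj_minus y).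

Fact hilbert_ip_linearl y : linear_for *%R (hilbert_ip^~ y).
Proof.
move=> a u v; rewrite /hilbert_ip; have [-> ->] := proj_linear a u v.
by rewrite !linearPl mulrDr addrACA.
Qed.

Fact hilbert_ip_linearr x : linear_for (Num.conj \; *%R) (hilbert_ip x).
Proof.
move=> a u v; rewrite /hilbert_ip; have [-> ->] := proj_linear a u v.
by rewrite !linearPr /= mulrDr addrACA.
Qed.

HB.instance Definition _ := bilinear_isBilinear.Build R[i] H H R[i] *%R
  (Num.conj \; *%R) hilbert_ip (hilbert_ip_linearl, hilbert_ip_linearr).

Fact hilbert_ip_hermitian x y :
  hilbert_ip x y = (-1) ^+ false * Num.conj (hilbert_ip y x).
Proof.
rewrite expr0 mul1r rmorphD /hilbert_ip.
by rewrite (hermC ip_plus) (hermC ip_minus) !expr0 !mul1r.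
Qed.

HB.instance Definition _ := isHermitianSesquilinear.Build R[i] H false Num.conj
  hilbert_ip hilbert_ip_hermitian.

(* [S] is the block operator matrix [[A, B], [C, D]]. *)
Definition has_block_matrix (S : H -> H) (A : Hplus -> Hplus)
  (B : Hminus -> Hplus) (C : Hplus -> Hminus) (D : Hminus -> Hminus) :=
  forall (xp : Hplus) (xm : Hminus),
    S (val xp + val xm) = val (A xp + B xm) + val (C xp + D xm).

End Krein.

Section Frames.
Context {R : realType} {H : lmodType R[i]} {f : hermitian_form H}.
Context (E : fundamental_decomposition f) {I : choiceType} (F : I -> H).

Definition hilbert_norm (x : H) : R := ipnorm (hilbert_ip E) x.

(* Norm convergence of the net of finite partial sums over [J]. *)
Definition has_sum (J : set I) (x : I -> H) (s : H) :=
  hilbert_norm (\sum_(i <- B | i \in J) x i - s) @[B --> totally] --> (0 : R).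

Definition square_sum (c : I -> R[i]) : \bar R :=
  \esum_(i in [set: I]) (complex.Re `|c i| ^+ 2)%:E.

Definition bessel_family := exists beta : R, forall x,
  (square_sum (fun i => hilbert_ip E x (F i)) <=
     (beta * hilbert_norm x ^+ 2)%:E)%E.

Definition index_plus : set I := [set i | 0 <= f (F i) (F i)].
Definition index_minus : set I := [set i | f (F i) (F i) < 0].

(* Range of the restriction to [J] of the synthesis operator on l2(I). *)
Definition synthesis_range (J : set I) : set H :=
  [set y | exists2 c : I -> R[i], (square_sum c < +oo)%E &
     has_sum J (fun i => c i *: F i) y].

Definition uniformly_positive (L : set H) :=
  submod_closed (mem L) /\
  exists2 a : R, 0 < a &
    forall x, L x -> (a * hilbert_norm x ^+ 2)%:C <= f x x.

Definition uniformly_negative (L : set H) :=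
  submod_closed (mem L) /\
  exists2 a : R, 0 < a &
    forall x, L x -> (a * hilbert_norm x ^+ 2)%:C <= - f x x.

Definition maximal_for (P : set H -> Prop) (L : set H) :=
  P L /\ forall L', P L' -> L `<=` L' -> L' = L.

Definition J_frame :=
  [/\ bessel_family,
      maximal_for uniformly_positive (synthesis_range index_plus) &
      maximal_for uniformly_negative (synthesis_range index_minus)].

Definition frame_operator_of (S : H -> H) := forall x, exists sp sm : H,
  [/\ has_sum index_plus (fun i => f x (F i) *: F i) sp,
      has_sum index_minus (fun i => f x (F i) *: F i) sm &
      S x = sp - sm].

End Frames.

(* The Hilbert norms of two fundamental decompositions are equivalent, so the
   choice of [E] does not matter. *)
Definition J_frame_operator {R : realType} {H : lmodType R[i]}
  (f : hermitian_form H) (S : H -> H) :=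
  exists (E : fundamental_decomposition f) (I : choiceType) (F : I -> H),
    J_frame E F /\ frame_operator_of E F S.

(* Main.v *)
Require Import Defs.
From HB Require Import structures.
From mathcomp Require Import all_boot all_order all_algebra ring lra.
From mathcomp Require Import sesquilinear complex.
From mathcomp Require Import all_classical all_reals all_analysis.
Import Order.TTheory GRing.Theory Num.Theory.
Import numFieldNormedType.Exports.
Local Open Scope classical_set_scope.
Local Open Scope complex_scope.
Local Open Scope ring_scope.

(** The two halves are one statement about Hilbert spaces V and W: the second
    is the first for A := D', K := L^*, D := A', with the components listed in
    the other order. So let S = [[A, -AK], [K^*A, D]] on V * W with A > 0,
    B := D + K^*AK > 0 and |K| < 1, and let l be a number for which S - l must
    be invertible.

    Substituting x = Az and subtracting K^* times the first row of S - l from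
    the second turns (S - l)(x, y) = 0 into
      A (l z - A z + K y) = 0  and  B y - l y + l K^* A z = 0.
    Pair these with z and y, and put al = <Az, z>, P = |Az|^2, be = <By, y>,
    Q = |y|^2, k = <Ky, Az>. An eigenvector gives
      (E1)  l al - P + k = 0,      (E2)  be - l Q + l k^* = 0.
    The imaginary part of l^* E1 + E2 is Im l (P - Q), so P = Q if l is not
    real. As |k| < sqrt (P Q), (E1) then puts l in the disc |l - P/al| < P/al,
    where P/al <= a_+, and (E2) puts 1/l in the disc |1/l - Q/be| < Q/be, which
    is Re l > be/(2Q) >= b_-/2. If 0 < l < min (a_-, b_-), (E1) makes k positive
    and (E2) makes it negative; if l <= 0, both k >= P and k >= Q would hold,
    against |k| < sqrt (P Q).

    Since S may have continuous spectrum, excluding eigenvectors is not enough.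
    Instead each of these arguments is turned into a pair of scalars s, t such
    that the real part of s E1 + t E2 is at least c (P + Q) for some c > 0
    ([separated_disc], [separated_half_plane], [separated_real]). Then the
    operator (z, y) |-> (s A (l z - A z + K y), t (B y - l y + l K^* A z)) is
    coercive, so it is invertible by the Lax-Milgram lemma ([lax_milgram]), and
    S - l is invertible because it differs from this operator by invertible
    triangular factors ([separated_invertible]). For real l > max (a_+, d_+),
    l - S itself is coercive, because the off-diagonal entries of S cancel in
    the real part of its quadratic form ([invertible_right_of_diagonal]). *)

(** * Inner products *)

Section InnerProduct.
Set Implicit Arguments.
Unset Strict Implicit.
Context {R : realType} {V : lmodType R[i]} (ip : hermitian_form V).

Lemma form_conj x y : ip y x = (ip x y)^*.
Proof. by rewrite hermC /= expr0 mul1r. Qed.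

Lemma Re_formC x y : complex.Re (ip y x) = complex.Re (ip x y).
Proof. by rewrite form_conj; case: (ip x y). Qed.

Lemma Im_form_diag x : complex.Im (ip x x) = 0.
Proof. by have := form_conj x x; case: (ip x x) => a b [] /=; lra. Qed.

Lemma formE x : ip x x = (complex.Re (ip x x))%:C.
Proof. by have := Im_form_diag x; case: (ip x x) => a b /= ->. Qed.

Lemma Re_formB (r : R) x y :
  complex.Re (ip (x - r%:C *: y) (x - r%:C *: y)) =
  complex.Re (ip x x) - 2 * r * complex.Re (ip x y)
    + r ^+ 2 * complex.Re (ip y y).
Proof.
rewrite linearBl linearZl_LR /= !linearBr !linearZr_LR /= (form_conj x y).
case: (ip x x) (ip y y) (ip x y) => [p p'] [q q'] [a b].
by simpc => /=; ring.
Qed.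

Lemma Re_formZ (a : R[i]) x : complex.Re (ip (a *: x) (a *: x)) =
  (complex.Re a ^+ 2 + complex.Im a ^+ 2) * complex.Re (ip x x).
Proof.
rewrite linearZl_LR /= linearZr_LR /=; move: (Im_form_diag x).
by case: (ip x x) a => [p p'] [a b] /= ->; simpc => /=; ring.
Qed.

Hypothesis ip_gt0 : positive_definite_form ip.

Lemma Re_form_ge0 x : 0 <= complex.Re (ip x x).
Proof.
have [->|x0] := eqVneq x 0; first by rewrite linear0l.
by move: (ip_gt0 x0); rewrite ltcE => /andP[_ /ltW].
Qed.

Lemma Re_form_eq0 x : complex.Re (ip x x) <= 0 -> x = 0.
Proof.
have [->//|x0] := eqVneq x 0.
by move: (ip_gt0 x0); rewrite ltcE => /andP[_ /= h]; rewrite leNgt h.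
Qed.

Lemma ipnorm_sqr x : ipnorm ip x ^+ 2 = complex.Re (ip x x).
Proof. by rewrite sqr_sqrtr// Re_form_ge0. Qed.

Lemma ipnorm_le x r : 0 <= r ->
  (ipnorm ip x <= r) = (complex.Re (ip x x) <= r ^+ 2).
Proof. by move=> r0; rewrite -ipnorm_sqr ler_sqr// nnegrE sqrtr_ge0. Qed.

(** Positivity of |x - r <x, y> y|^2 at r = 1/|y|^2. The modulus of <x, y> is
    kept as a sum of two real squares, the form in which the multipliers use
    it. *)
Lemma cauchy_schwarz x y :
  complex.Re (ip x y) ^+ 2 + complex.Im (ip x y) ^+ 2 <=
  complex.Re (ip x x) * complex.Re (ip y y).
Proof.
have [->|y0] := eqVneq y 0.
  by rewrite !linear0r /=; lra.
have n0 : 0 < complex.Re (ip y y).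
  by rewrite ltNge; apply: contra_neqN y0 => /Re_form_eq0.
have := Re_form_ge0 (x - (complex.Re (ip y y))^-1%:C *: (ip x y *: y)).
rewrite Re_formB Re_formZ linearZr_LR /=.
case: (ip x y) => a b; simpc => /=.
move: (complex.Re (ip y y)) n0 (complex.Re (ip x x)) => n n0 p h.
rewrite -subr_ge0 (_ : _ - _ =
  n * (p - 2 * n^-1 * (a * a + b * b) + n^-1 ^+ 2 * ((a ^+ 2 + b ^+ 2) * n))).
  by rewrite mulr_ge0// ltW.
by field; lra.
Qed.

Lemma Re_form_le x y : complex.Re (ip x y) <= ipnorm ip x * ipnorm ip y.
Proof.
have [/le_trans|/ltW c0] := leP (complex.Re (ip x y)) 0.
  by apply; rewrite mulr_ge0 ?sqrtr_ge0.
rewrite -ler_sqr ?nnegrE ?mulr_ge0 ?sqrtr_ge0// exprMn !ipnorm_sqr.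
by apply: le_trans (cauchy_schwarz x y); rewrite lerDl sqr_ge0.
Qed.

Lemma ipnormD x y : ipnorm ip (x + y) <= ipnorm ip x + ipnorm ip y.
Proof.
rewrite ipnorm_le ?addr_ge0 ?sqrtr_ge0//.
have -> : x + y = x - (-1)%:C *: y by rewrite rmorphN1 scaleN1r opprK.
by rewrite Re_formB sqrrD !ipnorm_sqr; have := Re_form_le x y; lra.
Qed.

End InnerProduct.

(** * The Lax-Milgram lemma *)

Section LaxMilgram.
Set Implicit Arguments.
Unset Strict Implicit.
Context {R : realType} {V : lmodType R[i]} (ip : hermitian_form V).
Hypothesis hilb : hilbert_space ip.

Lemma ipnormBC x y : ipnorm ip (x - y) = ipnorm ip (y - x).
Proof. by rewrite /ipnorm -opprB linearNl linearNr opprK. Qed.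

(** Summing the geometric series makes the sequence Cauchy; this is how the
    iteration in [lax_milgram] reaches its limit. *)
Lemma geometric_cauchy (u : nat -> V) (th e : R) : 0 <= th -> th < 1 ->
  (forall n, ipnorm ip (u n.+1 - u n) <= th ^+ n * e) ->
  exists l : V, ipnorm ip (u n - l) @[n --> \oo] --> (0 : R).
Proof.
have [ip_gt0 compl] := hilb.
move=> th0 th1 hu.
have th'0 : 0 < 1 - th by rewrite subr_gt0.
have e0 : 0 <= e.
  by have := hu 0%N; rewrite expr0 mul1r; apply: le_trans; rewrite sqrtr_ge0.
have tail n k :
    ipnorm ip (u (n + k)%N - u n) <= (th ^+ n - th ^+ (n + k)) * e / (1 - th).
  elim: k => [|k IH].
    by rewrite addn0 !subrr mul0r mul0r /ipnorm linear0l sqrtr0.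
  rewrite addnS -(subrKA (u (n + k)%N)).
  apply: le_trans (ipnormD ip_gt0 _ _) _; apply: le_trans (lerD (hu _) IH) _.
  rewrite le_eqVlt; apply/orP; left; apply/eqP; rewrite exprS.
  by field; rewrite gt_eqF.
have tailN n m : (n <= m)%N ->
    ipnorm ip (u m - u n) <= th ^+ n * (e / (1 - th)).
  move=> /subnKC <-; apply: le_trans (tail _ _) _; rewrite mulrA.
  rewrite ler_pM2r ?invr_gt0//; apply: ler_wpM2r => //.
  by rewrite gerBl exprn_ge0.
apply: compl => eps eps0.
have lim0 : th ^+ n * (e / (1 - th)) @[n --> \oo] --> (0 : R).
  rewrite -(mul0r (e / (1 - th))); apply: cvgMl.
  by apply: cvg_expr; rewrite ger0_norm.
have [N _ hN] := cvgr_lt _ lim0 _ eps0.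
exists N => m n; wlog nm : m n / (n <= m)%N.
  move=> hw hm hn; case/orP: (leq_total n m) => h; first exact: hw.
  by rewrite ipnormBC; exact: hw.
by move=> _ hn; apply: le_lt_trans (tailN _ _ nm) _; exact: hN.
Qed.

Variables (Q : V -> V) (M c : R).
Hypothesis QB : {morph Q : x y / x - y}.
Hypothesis c0 : 0 < c.
Hypothesis QM : forall u,
  complex.Re (ip (Q u) (Q u)) <= M * complex.Re (ip u u).
Hypothesis Qc : forall u,
  c * complex.Re (ip u u) <= complex.Re (ip (Q u) u).

(** Cauchy-Schwarz: c |u|^2 <= Re <Qu, u> <= |Qu| |u|. *)
Lemma coercive_bound u :
  c ^+ 2 * complex.Re (ip u u) <= complex.Re (ip (Q u) (Q u)).
Proof.
have [ip_gt0 _] := hilb.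
have := cauchy_schwarz ip_gt0 (Q u) u; have := Qc u.
have := Re_form_ge0 ip_gt0 u; have := Re_form_ge0 ip_gt0 (Q u).
case: (ip (Q u) u) => a b /=.
move: (complex.Re (ip (Q u) (Q u))) (complex.Re (ip u u)) => q n.
move=> q0 n0 h1 h2.
have [->|n1] := eqVneq n 0; first by rewrite mulr0.
have {n1 n0} n0 : 0 < n by rewrite lt_def n1.
rewrite -(ler_pM2r n0); apply: le_trans h2.
have : (c * n) ^+ 2 <= a ^+ 2.
  have cn : 0 < c * n by rewrite mulr_gt0.
  by rewrite ler_sqr ?nnegrE ?(ltW cn) ?(le_trans (ltW cn) h1).
have := sqr_ge0 b; lra.
Qed.

(** For small rho the map u |-> u - rho (Qu - g) is a contraction, since |d -
    rho Qd|^2 <= |d|^2 (1 - 2 rho c + rho^2 N) when |Qd|^2 <= N |d|^2; its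
    fixed point solves Qu = g. *)
Lemma lax_milgram g : exists u, Q u = g.
Proof.
have [ip_gt0 _] := hilb.
(* N >= c^2 makes the contraction factor 1 - c^2/N at the optimal rho = c/N
   nonnegative, so that its square root is meaningful. *)
pose N := `|M| + c ^+ 2.
have N0 : 0 < N by rewrite ltr_wpDl// exprn_gt0.
pose rho := c / N.
have rho0 : 0 < rho by rewrite divr_gt0.
pose th := Num.sqrt (1 - c ^+ 2 / N).
have th_arg : 0 <= 1 - c ^+ 2 / N.
  by rewrite subr_ge0 ler_pdivrMr// mul1r lerDr.
have th0 : 0 <= th by rewrite sqrtr_ge0.
have th1 : th < 1.
  rewrite -(@ltr_sqr _ th) ?nnegrE// expr1n sqr_sqrtr// gtrBl.
  by rewrite divr_gt0 ?exprn_gt0.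
have contract d : ipnorm ip (d - rho%:C *: Q d) <= th * ipnorm ip d.
  rewrite ipnorm_le ?mulr_ge0 ?sqrtr_ge0// exprMn ipnorm_sqr// sqr_sqrtr//.
  rewrite Re_formB Re_formC.
  have := QM d; have := Qc d; have := Re_form_ge0 ip_gt0 d.
  move: (complex.Re (ip d d)) (complex.Re (ip (Q d) d)) => n k.
  move: (complex.Re (ip (Q d) (Q d))) => q n0 h1 h2.
  have h3 : q <= N * n.
    apply: le_trans h2 _; apply: ler_wpM2r => //.
    by rewrite (le_trans (ler_norm _))// lerDl sqr_ge0.
  have : rho ^+ 2 * q <= rho ^+ 2 * (N * n) by rewrite ler_wpM2l ?sqr_ge0.
  have : rho * (c * n) <= rho * k by rewrite ler_wpM2l// ltW.
  have -> : rho ^+ 2 * (N * n) = rho * (c * n).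
    by rewrite /rho; field; rewrite gt_eqF.
  have -> : (1 - c ^+ 2 / N) * n = n - rho * (c * n).
    by rewrite /rho; field; rewrite gt_eqF.
  lra.
pose u := fix u n := if n is n.+1 then u n - rho%:C *: (Q (u n) - g) else 0.
have step n : u n.+1 - u n = - (rho%:C *: (Q (u n) - g)).
  by rewrite /= addrAC subrr sub0r.
clearbody u.
pose e := ipnorm ip (u 1%N - u 0%N).
have ud n : ipnorm ip (u n.+1 - u n) <= th ^+ n * e.
  elim: n => [|n IH]; first by rewrite expr0 mul1r.
  rewrite exprS -mulrA; apply: le_trans (ler_wpM2l th0 IH).
  apply: le_trans (contract (u n.+1 - u n)).
  rewrite le_eqVlt; apply/orP; left; apply/eqP; congr ipnorm.
  rewrite QB !step -opprD -scalerDr.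
  by rewrite [Q _ - g + _]addrC subrKA.
have [l hl] := geometric_cauchy th0 th1 ud.
exists l; apply/eqP; rewrite -subr_eq0; apply/eqP.
suff : ipnorm ip (Q l - g) <= 0.
  rewrite ipnorm_le// expr0n /=; exact: Re_form_eq0.
pose s := Num.sqrt `|M|.
have Qs v : ipnorm ip (Q v) <= s * ipnorm ip v.
  rewrite ipnorm_le ?mulr_ge0 ?sqrtr_ge0// exprMn ipnorm_sqr// sqr_sqrtr//.
  by apply: le_trans (QM v) _; rewrite ler_wpM2r ?Re_form_ge0// ler_norm.
have lim0 : s * ipnorm ip (u n - l) + rho^-1 * (th ^+ n * e) @[n --> \oo]
    --> (0 : R).
  suff : s * ipnorm ip (u n - l) + rho^-1 * (th ^+ n * e) @[n --> \oo]
      --> (s * 0 + rho^-1 * (0 * e) : R) by rewrite mul0r !mulr0 addr0.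
  apply: cvgD; first exact: cvgMr.
  by apply: cvgMr; apply: cvgMl; apply: cvg_expr; rewrite ger0_norm.
rewrite -(cvg_lim _ lim0)//; apply: limr_ge; first by apply/cvg_ex; exists 0.
near=> n.
have -> : Q l - g = Q (l - u n) + (Q (u n) - g) by rewrite QB subrKA.
apply: le_trans (ipnormD ip_gt0 _ _) _; apply: lerD.
  by rewrite (ipnormBC (u n)) Qs.
have -> : Q (u n) - g = (- rho^-1)%:C *: (u n.+1 - u n).
  rewrite step scalerN rmorphN scaleNr opprK scalerA -rmorphM /=.
  by rewrite mulVf ?gt_eqF// scale1r.
rewrite ipnorm_le ?mulr_ge0 ?invr_ge0 ?(ltW rho0) ?exprn_ge0 ?sqrtr_ge0//.
rewrite Re_formZ /= expr0n addr0 sqrrN exprMn ler_wpM2l ?sqr_ge0//.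
by rewrite -ipnorm_le ?mulr_ge0 ?exprn_ge0 ?sqrtr_ge0.
Unshelve. all: by end_near.
Qed.

Lemma coercive_invertible : boundedly_invertible ip Q.
Proof.
have [ip_gt0 _] := hilb.
have [T QT] := choice lax_milgram.
exists T; split=> //.
- move=> u; apply/eqP; rewrite -subr_eq0; apply/eqP/(Re_form_eq0 ip_gt0).
  have := coercive_bound (T (Q u) - u).
  by rewrite QB QT subrr linear0l /= pmulr_rle0 ?exprn_gt0.
- exists c^-1 => g; rewrite -ler_pdivrMl ?invr_gt0// invrK.
  rewrite -ler_sqr ?nnegrE ?mulr_ge0 ?sqrtr_ge0 ?(ltW c0)//.
  by rewrite exprMn !ipnorm_sqr//; have := coercive_bound (T g); rewrite QT.
Qed.

End LaxMilgram.

(** * Scalar multipliers *)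

Section Multipliers.
Set Implicit Arguments.
Unset Strict Implicit.
Context {R : realType}.
Implicit Types (l s t w k : R[i]) (kap am ap bm de al P be Q c : R).

(** What is known about the numbers al = <Az, z>, P = |Az|^2, be = <By, y>, Q
    = |y|^2 and k = <Ky, Az>. The constants am, ap, bm bound A and B, de is a
    positive lower bound for B, and kap < 1 bounds the norm of K. *)
Definition block_values kap am ap bm de al P be Q k :=
  [/\ 0 <= al, 0 <= P & 0 <= Q] /\
  [/\ am * al <= P, P <= ap * al, bm * Q <= be, de * Q <= be &
      complex.Re k ^+ 2 + complex.Im k ^+ 2 <= kap ^+ 2 * (P * Q)].

(** The real part of s E1 + t E2, with the scalar equations E1 and E2 of the
    overview. *)
Definition pencil_form l s t al P be Q k : R :=
  complex.Re (s * (l * al%:C - P%:C + k) + t * (be%:C - l * Q%:C + l * k^*)).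

(** A real linear functional of (E1, E2), with coefficients s and t, that is
    coercive on all admissible values: a certificate that l is in the
    resolvent set. The coefficients scale the rows of S - l, so both must be
    nonzero. *)
Definition separated kap am ap bm de l := exists s t c,
  [/\ s != 0, t != 0, 0 < c & forall al P be Q k,
    block_values kap am ap bm de al P be Q k ->
    c * (P + Q) <= pencil_form l s t al P be Q k].

Lemma complex_ReD (x y : R[i]) :
  complex.Re (x + y) = complex.Re x + complex.Re y.
Proof. by case: x y => a b []. Qed.

Lemma neq0_Re_mul s l : 0 < complex.Re (s * l) -> s != 0.
Proof. by apply: contraTneq => ->; rewrite mul0r ltxx. Qed.

(** The eigenvalue identity P = Q for nonreal l: adding the purely imaginary
    multiplier tau to the second equation, and tau l^* to the first, adds the
    real number (Q - P)/2, whatever al, be and k are. *)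
Lemma balance l s t al P be Q k (tau := ((2 * complex.Im l)^-1)%:C * 'i) :
  complex.Im l != 0 ->
  pencil_form l (s + tau * l^*) (t + tau) al P be Q k =
  pencil_form l s t al P be Q k + (Q - P) / 2.
Proof.
rewrite /pencil_form {}/tau.
case: l s t k => u v [a b] [x y] [p q] /= v0.
by simpc => /=; field.
Qed.

(** |k| <= kap sqrt (P Q), and the geometric mean is at most the arithmetic
    one. *)
Lemma cross_term kap w k P Q : 0 <= kap -> 0 <= P -> 0 <= Q ->
  complex.Re w ^+ 2 + complex.Im w ^+ 2 = 1 ->
  complex.Re k ^+ 2 + complex.Im k ^+ 2 <= kap ^+ 2 * (P * Q) ->
  - (kap * (P + Q) / 2) <= complex.Re (w * k).
Proof.
case: w k => a b [p q] /= kap0 P0 Q0 w1 hk.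
suff : `|a * p - b * q| <= kap * (P + Q) / 2 by rewrite ler_norml => /andP[].
have r0 : 0 <= kap * (P + Q) / 2 by rewrite mulr_ge0 ?mulr_ge0 ?addr_ge0.
rewrite -ler_sqr ?nnegrE// real_normK ?num_real//.
have -> : (kap * (P + Q) / 2) ^+ 2 =
    kap ^+ 2 * (P * Q) + (kap * (P - Q) / 2) ^+ 2 by field.
have h1 : (a * p - b * q) ^+ 2 + (a * q + b * p) ^+ 2 = p ^+ 2 + q ^+ 2.
  by rewrite -[RHS]mul1r -w1; ring.
have := sqr_ge0 (a * q + b * p); have := sqr_ge0 (kap * (P - Q) / 2).
lra.
Qed.

(** It is enough to find w of modulus 1 with Re (w (l al - P)) >= P: then Re
    (w E1) >= P - kap (P + Q)/2, and adding (Q - P)/2 by [balance] gives (1 -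
    kap)/2 (P + Q). If Re l > 0, w = l^*/l works outside the disc, because w l
    = l^* has positive real part and |l|^2 al >= 2 Re l ap al >= 2 Re l P; if
    Re l <= 0, w = -1 does. *)
Lemma separated_disc kap am ap bm de l : 0 <= kap -> kap < 1 ->
  complex.Im l != 0 ->
  (0 < complex.Re l ->
    2 * complex.Re l * ap <= complex.Re l ^+ 2 + complex.Im l ^+ 2) ->
  separated kap am ap bm de l.
Proof.
move=> kap0 kap1 v0 hl.
have n0 : 0 < complex.Re l ^+ 2 + complex.Im l ^+ 2.
  by rewrite ltr_wpDl ?sqr_ge0// lt_def sqrf_eq0 v0 sqr_ge0.
suff [w [w1 w0 hw]] : exists w,
    [/\ complex.Re w ^+ 2 + complex.Im w ^+ 2 = 1,
        w + ((2 * complex.Im l)^-1)%:C * 'i * l^* != 0 &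
        forall al P, 0 <= al -> 0 <= P -> P <= ap * al ->
          P <= complex.Re (w * (l * al%:C - P%:C))].
  exists (w + ((2 * complex.Im l)^-1)%:C * 'i * l^*),
    (0 + ((2 * complex.Im l)^-1)%:C * 'i), ((1 - kap) / 2).
  split=> //; first 2 last.
  - move=> al P be Q k [[al0 P0 Q0] [_ hP _ _ hk]].
    rewrite balance// /pencil_form mul0r addr0 [w * _]mulrDr complex_ReD.
    have := cross_term kap0 P0 Q0 w1 hk; have := hw _ _ al0 P0 hP.
    lra.
  - rewrite add0r mulf_neq0 ?fmorph_eq0 ?invr_eq0 ?mulf_neq0//.
    by rewrite eq_complex /= oner_eq0 andbF.
  - by rewrite divr_gt0// subr_gt0.
have [u0|u0] := ltP 0 (complex.Re l).
  have {}hl := hl u0.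
  case: l v0 hl n0 u0 => u v /= v0 hl n0 u0; set n := u ^+ 2 + v ^+ 2 in n0 hl.
  exists (((u ^+ 2 - v ^+ 2) / n) +i* (- (2 * u * v) / n)); split.
  - by rewrite /= /n; field; rewrite gt_eqF.
  - apply: (@neq0_Re_mul _ (u +i* v)); simpc => /=.
    rewrite [X in _ < X](_ : _ = u)//.
    by rewrite /n; field; rewrite v0 gt_eqF.
  - move=> al P al0 P0 hP; simpc => /=.
    rewrite -subr_ge0 [X in _ <= X](_ : _ = u * (n * al - 2 * u * P) / n).
      rewrite divr_ge0 ?(ltW n0)// mulr_ge0 ?(ltW u0)// subr_ge0.
      apply: (@le_trans _ _ (2 * u * ap * al)); last by rewrite ler_wpM2r.
      by rewrite -[leRHS]mulrA ler_wpM2l// mulr_ge0 ?(ltW u0).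
    by rewrite /n; field; rewrite gt_eqF.
exists (-1); case: l v0 hl n0 u0 => u v /= v0 hl n0 u0; split.
- by rewrite oppr0 sqrrN expr1n expr0n addr0.
- rewrite -oppr_eq0; apply: (@neq0_Re_mul _ 1); simpc => /=.
  by have -> : 1 - (2 * v)^-1 * v = 2^-1; [field|rewrite invr_gt0].
- move=> al P al0 P0 _; simpc => /=.
  by have := mulr_ge0_le0 al0 u0; lra.
Qed.

(** The mirror image of [separated_disc] under l |-> 1/l, with the roles of
    the two equations exchanged: find w with |w l| = 1 and Re (w (be - l Q))
    >= Q, and use [balance] to turn Q into (P + Q)/2. The choices are w =
    1/l^* for Re l > 0 and w = -1/l for Re l <= 0. *)
Lemma separated_half_plane kap am ap bm de l : 0 <= kap -> kap < 1 ->
  0 <= de -> complex.Im l != 0 -> 2 * complex.Re l <= bm ->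
  separated kap am ap bm de l.
Proof.
move=> kap0 kap1 de0 v0 hl.
have n0 : 0 < complex.Re l ^+ 2 + complex.Im l ^+ 2.
  by rewrite ltr_wpDl ?sqr_ge0// lt_def sqrf_eq0 v0 sqr_ge0.
pose tau : R[i] := ((2 * complex.Im l)^-1)%:C * 'i.
suff [w [w1 w0 hw]] : exists w,
    [/\ complex.Re (w * l) ^+ 2 + complex.Im (w * l) ^+ 2 = 1,
        w - tau != 0 &
        forall be Q, 0 <= Q -> 0 <= be -> bm * Q <= be ->
          Q <= complex.Re (w * (be%:C - l * Q%:C))].
  exists (- (tau * l^*)), (w - tau), ((1 - kap) / 2).
  split=> //; first 2 last.
  - move=> al P be Q k [[al0 P0 Q0] [_ _ h1 h2 hk]].
    have be0 : 0 <= be by apply: le_trans h2; rewrite mulr_ge0.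
    have := balance (- (tau * l^*)) (w - tau) al P be Q k v0.
    rewrite -/tau addNr subrK {1}/pencil_form mul0r add0r [w * _]mulrDr.
    rewrite complex_ReD (mulrA w).
    have hk' : complex.Re (k^*) ^+ 2 + complex.Im (k^*) ^+ 2 <=
        kap ^+ 2 * (P * Q) by case: k hk => p q /=; rewrite sqrrN.
    have := cross_term kap0 P0 Q0 w1 hk'; have := hw _ _ Q0 be0 h1.
    lra.
  - have tau0 : tau != 0.
      rewrite /tau mulf_neq0 ?fmorph_eq0 ?invr_eq0 ?mulf_neq0//.
      by rewrite eq_complex /= oner_eq0 andbF.
    rewrite oppr_eq0 mulf_neq0//.
    case: (l) v0 => u v /= v0.
    by rewrite eq_complex /= oppr_eq0 negb_and v0 orbT.
  - by rewrite divr_gt0// subr_gt0.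
have [u0|u0] := ltP 0 (complex.Re l).
  rewrite {}/tau; case: l v0 hl n0 u0 => u v /= v0 hl n0 u0.
  set n := u ^+ 2 + v ^+ 2 in n0 *.
  exists ((u / n) +i* (v / n)); split.
  - by simpc; rewrite /= /n; field; rewrite gt_eqF.
  - apply: (@neq0_Re_mul _ (u -i* v)); simpc => /=.
    rewrite [X in _ < X](_ : _ = 2^-1) ?invr_gt0//.
    by rewrite /n; field; rewrite v0 gt_eqF.
  - move=> be Q Q0 be0 hQ; simpc => /=.
    rewrite -subr_ge0 [X in _ <= X](_ : _ = u * (be - 2 * u * Q) / n).
      rewrite divr_ge0 ?(ltW n0)// mulr_ge0 ?(ltW u0)// subr_ge0.
      by apply: le_trans hQ; rewrite ler_wpM2r.
    by rewrite /n; field; rewrite gt_eqF.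
rewrite {}/tau; case: l v0 hl n0 u0 => u v /= v0 hl n0 u0.
set n := u ^+ 2 + v ^+ 2 in n0 *.
exists ((- u / n) +i* (v / n)); split.
- by simpc; rewrite /= /n; field; rewrite gt_eqF.
- apply: (@neq0_Re_mul _ (- u -i* v)); simpc => /=.
  rewrite [X in _ < X](_ : _ = 2^-1) ?invr_gt0//.
  by rewrite /n; field; rewrite v0 gt_eqF.
- move=> be Q Q0 be0 hQ; simpc => /=.
  rewrite -subr_ge0 [X in _ <= X](_ : _ = - u * be / n).
    by rewrite divr_ge0 ?(ltW n0)// mulr_ge0 ?oppr_ge0.
  by rewrite /n; field; rewrite gt_eqF.
Qed.

(** For 0 < x, s = -1 and t = 1/x cancel the real part of k and leave (P - x
    al) + (be/x - Q), both positive. For x <= 0 all terms except those in k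
    are nonnegative with s = -1 and any t > 0; t = 1/(de - x) also covers x =
    0 and keeps the coefficient of Re k between -2 and 0. *)
Lemma separated_real kap am ap bm de (x : R) : 0 <= kap -> kap < 1 ->
  0 < de -> x < am -> x < bm -> separated kap am ap bm de x%:C.
Proof.
move=> kap0 kap1 de0 xa xb; have [x0|x0] := ltP 0 x.
  exists (-1), (x^-1)%:C, (Num.min (1 - x / am) (bm / x - 1)); split.
  - by rewrite oppr_eq0 oner_eq0.
  - by rewrite fmorph_eq0 invr_eq0 gt_eqF.
  - rewrite lt_min !subr_gt0 ltr_pdivrMr ?(lt_trans x0)// mul1r xa.
    by rewrite ltr_pdivlMr// mul1r.
  - move=> al P be Q [p q] [[al0 P0 Q0] [h1 _ h2 _ _]].
    rewrite /pencil_form; simpc => /=.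
    rewrite [X in _ <= X](_ : _ = (P - x * al) + (be / x - Q)); last first.
      by field; rewrite gt_eqF.
    have am0 := lt_trans x0 xa.
    rewrite mulrDr lerD//.
      apply: (@le_trans _ _ ((1 - x / am) * P)).
        by rewrite ler_wpM2r// ge_min lexx.
      rewrite -subr_ge0 [X in _ <= X](_ : _ = x / am * (P - am * al)).
        by rewrite mulr_ge0 ?divr_ge0 ?(ltW x0) ?(ltW am0)// subr_ge0.
      by field; rewrite gt_eqF.
    apply: (@le_trans _ _ ((bm / x - 1) * Q)).
      by rewrite ler_wpM2r// ge_min lexx orbT.
    rewrite -subr_ge0 [X in _ <= X](_ : _ = (be - bm * Q) / x).
      by rewrite divr_ge0 ?(ltW x0)// subr_ge0.
    by field; rewrite gt_eqF.
have dx : 0 < de - x by rewrite subr_gt0 (le_lt_trans x0).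
pose T := (de - x)^-1.
have T0 : 0 < T by rewrite invr_gt0.
exists (-1), T%:C, (1 - kap); split.
- by rewrite oppr_eq0 oner_eq0.
- by rewrite fmorph_eq0 gt_eqF.
- by rewrite subr_gt0.
- move=> al P be Q k [[al0 P0 Q0] [_ _ _ h1 hk]].
  have w1 : complex.Re (-1 : R[i]) ^+ 2 + complex.Im (-1 : R[i]) ^+ 2 = 1.
    by rewrite /= oppr0 sqrrN expr1n expr0n addr0.
  have w2 : complex.Re (1 : R[i]) ^+ 2 + complex.Im (1 : R[i]) ^+ 2 = 1.
    by rewrite /= expr1n expr0n addr0.
  have := cross_term kap0 P0 Q0 w1 hk; have := cross_term kap0 P0 Q0 w2 hk.
  rewrite /pencil_form; case: k {hk} => p q; simpc => /= c1 c2.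
  have e1 : Q <= T * (be - x * Q).
    rewrite -ler_pdivrMl// /T invrK; lra.
  have e2 : 0 <= - (T * x) <= 1.
    rewrite oppr_ge0 mulr_ge0_le0 ?(ltW T0)//= -mulrN mulrC ler_pdivrMr// mul1r.
    lra.
  case/andP: e2 => e2 e3.
  have e4 : 0 <= - x * al by rewrite mulr_ge0 ?oppr_ge0.
  have e5 : - (T * x) * p <= - (T * x) * (kap * (P + Q) / 2).
    by rewrite ler_wpM2l//; lra.
  have e6 : - (T * x) * (kap * (P + Q) / 2) <= kap * (P + Q) / 2.
    by rewrite ler_piMl// divr_ge0// mulr_ge0// addr_ge0.
  lra.
Qed.


End Multipliers.

(** * Bounded operators and products of Hilbert spaces *)

Section BoundedOperators.
Set Implicit Arguments.
Unset Strict Implicit.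
Context {R : realType}.

Lemma bounded_sqr (V W : lmodType R[i]) (ipV : hermitian_form V)
    (ipW : hermitian_form W) (T : V -> W) :
  positive_definite_form ipV -> positive_definite_form ipW ->
  bounded_operator ipV ipW T -> exists2 M, 0 < M &
    forall x, complex.Re (ipW (T x) (T x)) <= M * complex.Re (ipV x x).
Proof.
move=> posV posW [M hM]; exists (M ^+ 2 + 1) => [|x].
  by rewrite ltr_wpDl ?sqr_ge0.
have := hM x; have := Re_form_ge0 posV x.
rewrite -!ipnorm_sqr// => _ h.
have : ipnorm ipW (T x) ^+ 2 <= (M * ipnorm ipV x) ^+ 2.
  by rewrite ler_sqr ?nnegrE ?sqrtr_ge0// (le_trans _ h)// sqrtr_ge0.
have := sqr_ge0 (ipnorm ipV x); rewrite exprMn; lra.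
Qed.

Lemma bounded_comp (U V W : lmodType R[i]) (ipU : hermitian_form U)
    (ipV : hermitian_form V) (ipW : hermitian_form W)
    (S : V -> W) (T : U -> V) :
  bounded_operator ipV ipW S -> bounded_operator ipU ipV T ->
  bounded_operator ipU ipW (fun x => S (T x)).
Proof.
move=> [M hM] [N hN]; exists (`|M| * N) => x; apply: le_trans (hM _) _.
rewrite -mulrA; apply: (@le_trans _ _ (`|M| * ipnorm ipV (T x))).
  by rewrite ler_wpM2r ?sqrtr_ge0 ?ler_norm.
by rewrite ler_wpM2l.
Qed.

Section Combinations.
Context {U V : lmodType R[i]} (ipU : hermitian_form U) (ipV : hermitian_form V).

Lemma bounded_id : bounded_operator ipU ipU id.
Proof. by exists 1 => x; rewrite mul1r. Qed.

Lemma bounded_add (S T : U -> V) : positive_definite_form ipV ->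
  bounded_operator ipU ipV S -> bounded_operator ipU ipV T ->
  bounded_operator ipU ipV (fun x => S x + T x).
Proof.
move=> posV [M hM] [N hN]; exists (M + N) => x.
by apply: le_trans (ipnormD posV _ _) _; rewrite mulrDl lerD.
Qed.

Lemma bounded_scale (a : R[i]) (T : U -> V) : positive_definite_form ipV ->
  bounded_operator ipU ipV T -> bounded_operator ipU ipV (fun x => a *: T x).
Proof.
move=> posV; apply: bounded_comp.
exists (Num.sqrt (complex.Re a ^+ 2 + complex.Im a ^+ 2)) => x.
rewrite ipnorm_le// ?mulr_ge0 ?sqrtr_ge0// Re_formZ exprMn ipnorm_sqr//.
by rewrite sqr_sqrtr ?addr_ge0 ?sqr_ge0.
Qed.

Lemma bounded_opp (T : U -> V) : positive_definite_form ipV ->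
  bounded_operator ipU ipV T -> bounded_operator ipU ipV (fun x => - T x).
Proof.
move=> posV [M hM]; exists M => x.
by rewrite /ipnorm linearNl linearNr opprK; exact: hM.
Qed.

End Combinations.

Lemma boundedly_invertible_opp (U : lmodType R[i]) (ip : hermitian_form U)
    (T : U -> U) : positive_definite_form ip ->
  boundedly_invertible ip (fun x => - T x) -> boundedly_invertible ip T.
Proof.
move=> posU [T' [h1 h2 h3]]; exists (fun x => T' (- x)); split => [x|x|].
- exact: h1.
- by rewrite -[T _]opprK h2 opprK.
- by apply: (bounded_comp h3); apply/bounded_opp/bounded_id.
Qed.

(** Transport of invertibility from V * W to the Krein space, where a
    fundamental decomposition supplies phi. *)
Lemma boundedly_invertible_isometry (U H : lmodType R[i])
    (ipU : hermitian_form U) (ipH : hermitian_form H) (phi : U -> H)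
    (psi : H -> U) (T : U -> U) (S : H -> H) :
  cancel phi psi -> cancel psi phi ->
  (forall u, ipnorm ipH (phi u) = ipnorm ipU u) ->
  (forall u, S (phi u) = phi (T u)) ->
  boundedly_invertible ipU T -> boundedly_invertible ipH S.
Proof.
move=> phiK psiK iso ST [T' [h1 h2 [M hM]]].
exists (fun x => phi (T' (psi x))); split => [x|x|].
- by rewrite -[in S x](psiK x) ST phiK h1.
- by rewrite ST h2.
- by exists M => x; rewrite iso (le_trans (hM _))// -iso psiK.
Qed.

End BoundedOperators.

Section ProductForm.
Set Implicit Arguments.
Unset Strict Implicit.
Context {R : realType} {V W : lmodType R[i]}.
Variables (ipV : hermitian_form V) (ipW : hermitian_form W).

Definition prod_form (u v : V * W) : R[i] := ipV u.1 v.1 + ipW u.2 v.2.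

Fact prod_form_linearl v : linear_for *%R (prod_form^~ v).
Proof. by move=> a x y; rewrite /prod_form !linearPl mulrDr addrACA. Qed.

Fact prod_form_linearr u : linear_for (Num.conj \; *%R) (prod_form u).
Proof. by move=> a x y; rewrite /prod_form !linearPr /= mulrDr addrACA. Qed.

HB.instance Definition _ := bilinear_isBilinear.Build R[i] (V * W)%type
  (V * W)%type R[i] *%R (Num.conj \; *%R) prod_form
  (prod_form_linearl, prod_form_linearr).

Fact prod_form_hermitian u v :
  prod_form u v = (-1) ^+ false * Num.conj (prod_form v u).
Proof.
rewrite expr0 mul1r rmorphD /prod_form.
by rewrite (hermC ipV) (hermC ipW) !expr0 !mul1r.
Qed.

HB.instance Definition _ := isHermitianSesquilinear.Build R[i] (V * W)%type
  false Num.conj prod_form prod_form_hermitian.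

Lemma Re_prod_form u : complex.Re (prod_form u u) =
  complex.Re (ipV u.1 u.1) + complex.Re (ipW u.2 u.2).
Proof. exact: complex_ReD. Qed.

Hypothesis (hilbV : hilbert_space ipV) (hilbW : hilbert_space ipW).
Let posV := hilbV.1.
Let posW := hilbW.1.

Lemma prod_form_posdef : positive_definite_form prod_form.
Proof.
move=> [x y] /=; rewrite -pair_eqE /= negb_and /prod_form /=.
have ge0 (U : lmodType R[i]) (ip : hermitian_form U) z :
    positive_definite_form ip -> 0 <= ip z z.
  by move=> pos; rewrite formE ler0c Re_form_ge0.
case/orP=> [/posV|/posW] h; [rewrite ltr_pwDl|rewrite ltr_wpDl] => //;
  exact: ge0.
Qed.

Lemma ipnorm_fst u : ipnorm ipV u.1 <= ipnorm prod_form u.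
Proof.
by rewrite ipnorm_le ?sqrtr_ge0// (ipnorm_sqr prod_form_posdef) Re_prod_form
  lerDl Re_form_ge0.
Qed.

Lemma ipnorm_snd u : ipnorm ipW u.2 <= ipnorm prod_form u.
Proof.
by rewrite ipnorm_le ?sqrtr_ge0// (ipnorm_sqr prod_form_posdef) Re_prod_form
  lerDr Re_form_ge0.
Qed.

Lemma ipnorm_pair u : ipnorm prod_form u <= ipnorm ipV u.1 + ipnorm ipW u.2.
Proof.
rewrite (ipnorm_le prod_form_posdef) ?addr_ge0 ?sqrtr_ge0// Re_prod_form.
rewrite sqrrD !ipnorm_sqr// addrAC lerDl mulrn_wge0// mulr_ge0 ?sqrtr_ge0//.
Qed.

Lemma prod_form_hilbert : hilbert_space prod_form.
Proof.
split; first exact: prod_form_posdef.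
move=> u cu.
have [x hx] : exists x, ipnorm ipV ((u n).1 - x) @[n --> \oo] --> (0 : R).
  apply: hilbV.2 => e /cu[N hN]; exists N => m n mN nN.
  exact: le_lt_trans (ipnorm_fst (u m - u n)) (hN _ _ mN nN).
have [y hy] : exists y, ipnorm ipW ((u n).2 - y) @[n --> \oo] --> (0 : R).
  apply: hilbW.2 => e /cu[N hN]; exists N => m n mN nN.
  exact: le_lt_trans (ipnorm_snd (u m - u n)) (hN _ _ mN nN).
exists (x, y).
have h0 : ipnorm ipV ((u n).1 - x) + ipnorm ipW ((u n).2 - y) @[n --> \oo]
    --> (0 : R) by rewrite -(addr0 0); exact: cvgD.
apply: squeeze_cvgr (cvg_cst 0) h0; near=> n.
by rewrite sqrtr_ge0 (ipnorm_pair (u n - (x, y))).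
Unshelve. all: by end_near.
Qed.

Lemma bounded_pair (U : lmodType R[i]) (ipU : hermitian_form U)
    (T : U -> V * W) :
  bounded_operator ipU ipV (fun u => (T u).1) ->
  bounded_operator ipU ipW (fun u => (T u).2) ->
  bounded_operator ipU prod_form T.
Proof.
move=> [M hM] [N hN]; exists (M + N) => u.
by apply: le_trans (ipnorm_pair _) _; rewrite mulrDl lerD.
Qed.

Lemma bounded_fst : bounded_operator prod_form ipV fst.
Proof. by exists 1 => u; rewrite mul1r ipnorm_fst. Qed.

Lemma bounded_snd : bounded_operator prod_form ipW snd.
Proof. by exists 1 => u; rewrite mul1r ipnorm_snd. Qed.

End ProductForm.

(** * Positive operators and adjoints *)

Section UniformlyPositive.
Set Implicit Arguments.
Unset Strict Implicit.
Context {R : realType} {V : lmodType R[i]} (ip : hermitian_form V).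
Hypothesis pos : positive_definite_form ip.

Lemma selfadj_formE (T : V -> V) x : self_adjoint ip T ->
  ip (T x) x = (complex.Re (ip (T x) x))%:C.
Proof.
move=> sa; have : ip (T x) x = (ip (T x) x)^* by rewrite -form_conj sa.
case: (ip (T x) x) => a b [] b0.
by apply/eqP; rewrite eq_complex /= eqxx /=; lra.
Qed.

(** T <= a gives T^2 <= a T: expand <Tw, w> >= 0 for w = x - r Tx, take r =
    1/a when a > 0. If a <= 0 the form vanishes and r = 1 shows that T does
    too. *)
Lemma form_le_upper (T : V -> V) (a : R) : linear T -> self_adjoint ip T ->
  (forall x, 0 <= complex.Re (ip (T x) x)) ->
  (forall x, complex.Re (ip (T x) x) <= a * complex.Re (ip x x)) ->
  forall x, complex.Re (ip (T x) (T x)) <= a * complex.Re (ip (T x) x).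
Proof.
move=> Tlin sa Tge0 Tle x.
have key r : 2 * r * complex.Re (ip (T x) (T x)) <=
    complex.Re (ip (T x) x) + r ^+ 2 * (a * complex.Re (ip (T x) (T x))).
  apply: (@le_trans _ _ (complex.Re (ip (T x) x) +
      r ^+ 2 * complex.Re (ip (T (T x)) (T x)))); last first.
    by rewrite lerD2l ler_wpM2l ?sqr_ge0.
  have := Tge0 ((- r)%:C *: T x + x).
  rewrite Tlin !linearDl /= !linearDr /= !linearZl_LR /= !linearZr_LR /=.
  rewrite (sa (T x) x).
  case: (ip (T x) (T x)) (ip (T (T x)) (T x)) (ip (T x) x).
  move=> p p' [q q'] [t t']; simpc; rewrite /= /GRing.scale /=; lra.
have P0 := Re_form_ge0 pos (T x).
have [a0|a0] := ltP 0 a.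
  rewrite -ler_pdivrMl//; have := key a^-1; rewrite mulrA.
  have -> : a^-1 ^+ 2 * a = a^-1 by field; rewrite gt_eqF.
  lra.
have N0 := Re_form_ge0 pos x.
have h1 : a * complex.Re (ip x x) <= 0 by rewrite mulr_le0_ge0.
have h2 : a * complex.Re (ip (T x) (T x)) <= 0 by rewrite mulr_le0_ge0.
have := Tge0 x; have := Tle x; have := key 1; rewrite expr1n => k1 k2 k3.
have -> : complex.Re (ip (T x) x) = 0 by lra.
lra.
Qed.

(** T >= a > 0 gives T^2 >= a T, from |Tx - a x|^2 >= 0. *)
Lemma form_ge_lower (T : V -> V) (a : R) :
  (forall x, 0 <= complex.Re (ip (T x) x)) ->
  (forall x, a * complex.Re (ip x x) <= complex.Re (ip (T x) x)) ->
  forall x, a * complex.Re (ip (T x) x) <= complex.Re (ip (T x) (T x)).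
Proof.
move=> Tge0 Tge x; have P0 := Re_form_ge0 pos (T x).
have [a0|a0] := ltP 0 a; last by rewrite (le_trans _ P0)// mulr_le0_ge0.
have := Re_form_ge0 pos (T x - a%:C *: x); rewrite Re_formB.
have : a * (a * complex.Re (ip x x)) <= a * complex.Re (ip (T x) x).
  by rewrite ler_wpM2l// ltW.
lra.
Qed.

Lemma invertible_bounded_below (T : V -> V) : boundedly_invertible ip T ->
  exists2 m, 0 < m &
    forall x, complex.Re (ip x x) <= m * complex.Re (ip (T x) (T x)).
Proof.
move=> [T' [TK _ /(bounded_sqr pos pos)[m m0 hm]]]; exists m => // x.
by rewrite -{1 2}(TK x).
Qed.

Lemma uniformly_positive_ge0 (T : V -> V) : linear T ->
  uniformly_positive_operator ip T -> forall x, 0 <= complex.Re (ip (T x) x).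
Proof.
move=> Tlin [_ _ Tpos _] x; have [->|/Tpos] := eqVneq x 0.
  by rewrite linear0r.
by rewrite ltcE => /andP[_ /ltW].
Qed.

(** |x|^2 <= m |Tx|^2 by invertibility and |Tx|^2 <= a <Tx, x> by
    [form_le_upper]. *)
Lemma uniformly_positive_coercive (T : V -> V) : linear T ->
  uniformly_positive_operator ip T -> exists2 de, 0 < de &
    forall x, de * complex.Re (ip x x) <= complex.Re (ip (T x) x).
Proof.
move=> Tlin upT; have Tge0 := uniformly_positive_ge0 Tlin upT.
case: upT => -[M hM] sa _ /invertible_bounded_below[m m0 hm].
pose a := `|M| + 1.
have a0 : 0 < a by rewrite ltr_wpDl.
have Tle x : complex.Re (ip (T x) x) <= a * complex.Re (ip x x).
  apply: le_trans (Re_form_le pos _ _) _; rewrite -ipnorm_sqr// expr2 mulrA.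
  rewrite ler_wpM2r ?sqrtr_ge0//; apply: le_trans (hM x) _.
  by rewrite ler_wpM2r ?sqrtr_ge0// (le_trans (ler_norm _))// lerDl.
exists (m * a)^-1 => [|x]; first by rewrite invr_gt0 mulr_gt0.
rewrite ler_pdivrMl ?mulr_gt0//; apply: le_trans (hm x) _.
by rewrite -mulrA ler_pM2l// form_le_upper.
Qed.

End UniformlyPositive.

Section Adjoint.
Set Implicit Arguments.
Unset Strict Implicit.
Context {R : realType} {V W : lmodType R[i]} (ipV : hermitian_form V)
  (ipW : hermitian_form W).

Lemma adjoint_sym (K : W -> V) (K' : V -> W) :
  is_adjoint ipW ipV K K' -> is_adjoint ipV ipW K' K.
Proof. by move=> adj x y; rewrite form_conj -adj -form_conj. Qed.

Lemma adjoint_norm_le (K : W -> V) (K' : V -> W) (kap : R) :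
  positive_definite_form ipV -> positive_definite_form ipW ->
  is_adjoint ipW ipV K K' -> 0 <= kap ->
  (forall y, ipnorm ipV (K y) <= kap * ipnorm ipW y) ->
  forall x, ipnorm ipW (K' x) <= kap * ipnorm ipV x.
Proof.
move=> posV posW adj kap0 hK x.
have := hK (K' x); have := Re_form_le posV (K (K' x)) x.
rewrite adj -ipnorm_sqr//.
have n0 : 0 <= ipnorm ipW (K' x) by rewrite sqrtr_ge0.
have m0 : 0 <= ipnorm ipV x by rewrite sqrtr_ge0.
have [->|n1] := eqVneq (ipnorm ipW (K' x)) 0; first by rewrite mulr_ge0.
move=> h1 h2; have {n1 n0}n0 : 0 < ipnorm ipW (K' x) by rewrite lt_def n1.
rewrite -(ler_pM2l n0) -expr2; apply: le_trans h1 _.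
by rewrite mulrA (mulrC _ kap) ler_wpM2r.
Qed.

End Adjoint.

(** * Block operators *)

Section BlockOperator.
Set Implicit Arguments.
Unset Strict Implicit.
Context {R : realType} {V W : lmodType R[i]} (ipV : hermitian_form V)
  (ipW : hermitian_form W).
Hypothesis (hilbV : hilbert_space ipV) (hilbW : hilbert_space ipW).
Let posV := hilbV.1.
Let posW := hilbW.1.
Variables (A : {linear V -> V}) (K : {linear W -> V}) (K' : {linear V -> W})
  (D : {linear W -> W}).

Definition block_operator (u : V * W) : V * W :=
  (A u.1 - A (K u.2), K' (A u.1) + D u.2).

(** The operator B of the overview: D is the lower right entry of S, and B is
    the Schur complement of A in S. *)
Definition schur_operator (y : W) : W := D y + K' (A (K y)).

Lemma schur_linear : linear schur_operator.
Proof. by move=> a x y; rewrite /schur_operator !linearP scalerDr addrACA. Qed.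

Hypothesis adjK : is_adjoint ipW ipV K K'.
Hypothesis upA : uniformly_positive_operator ipV A.
Hypothesis upB : uniformly_positive_operator ipW schur_operator.
Variables (kap am ap bm : R).
Hypothesis kap0 : 0 <= kap.
Hypothesis K_le : forall y, ipnorm ipV (K y) <= kap * ipnorm ipW y.
Hypothesis A_ge : forall x,
  am * complex.Re (ipV x x) <= complex.Re (ipV (A x) x).
Hypothesis A_le : forall x,
  complex.Re (ipV (A x) x) <= ap * complex.Re (ipV x x).
Hypothesis B_ge : forall y,
  bm * complex.Re (ipW y y) <= complex.Re (ipW (schur_operator y) y).

Let A_linear : linear A := linearP A.
Let bddA : bounded_operator ipV ipV A. Proof. by case: upA. Qed.
Let bddB : bounded_operator ipW ipW schur_operator. Proof. by case: upB. Qed.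
Let bddK : bounded_operator ipW ipV K. Proof. by exists kap. Qed.
Let bddK' : bounded_operator ipV ipW K'.
Proof. by exists kap; exact: adjoint_norm_le. Qed.
Let saA : self_adjoint ipV A. Proof. by case: upA. Qed.
Let saB : self_adjoint ipW schur_operator. Proof. by case: upB. Qed.

Lemma block_values_of de x y :
  (forall y, de * complex.Re (ipW y y) <=
    complex.Re (ipW (schur_operator y) y)) ->
  block_values kap am ap bm de
    (complex.Re (ipV (A x) x)) (complex.Re (ipV (A x) (A x)))
    (complex.Re (ipW (schur_operator y) y)) (complex.Re (ipW y y))
    (ipV (K y) (A x)).
Proof.
move=> hde; have Age0 := uniformly_positive_ge0 A_linear upA.
split; first by split; [exact: Age0|exact: Re_form_ge0|exact: Re_form_ge0].
split=> //; first exact: form_ge_lower; first exact: form_le_upper.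
apply: le_trans (cauchy_schwarz posV _ _) _.
rewrite (mulrC (complex.Re (ipV (A x) (A x)))) mulrA ler_wpM2r ?Re_form_ge0//.
rewrite -!ipnorm_sqr// -exprMn ler_sqr ?nnegrE ?mulr_ge0 ?sqrtr_ge0//.
Qed.

(** The operator to which the Lax-Milgram lemma is applied; its quadratic form
    is [pencil_form] by [pencil_formE]. The first unknown is z = A^-1 x, so
    that no inverse of A occurs. *)
Definition pencil_operator (l s t : R[i]) (u : V * W) : V * W :=
  (s *: A (l *: u.1 - A u.1 + K u.2),
   t *: (schur_operator u.2 - l *: u.2 + l *: K' (A u.1))).

Lemma pencil_operatorB l s t : {morph pencil_operator l s t : u v / u - v}.
Proof.
have BB y y' : schur_operator (y - y') = schur_operator y - schur_operator y'.
  by rewrite /schur_operator !raddfB /= addrACA -opprD.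
have subACA (U : zmodType) (a b c d e f : U) :
    (a - b) - (c - d) + (e - f) = (a - c + e) - (b - d + f).
  by rewrite !opprD !opprK (addrACA a) (addrACA (a - c)).
move=> [x y] [x' y']; rewrite /pencil_operator /=; congr pair.
  rewrite -scalerBr -raddfB; congr (_ *: A _).
  by rewrite (raddfB A) (raddfB K) /= scalerBr subACA.
rewrite -scalerBr; congr (_ *: _).
by rewrite BB (raddfB A) (raddfB K') /= !scalerBr subACA.
Qed.

Lemma pencil_formE l s t x y :
  complex.Re (prod_form ipV ipW (pencil_operator l s t (x, y)) (x, y)) =
  pencil_form l s t
    (complex.Re (ipV (A x) x)) (complex.Re (ipV (A x) (A x)))
    (complex.Re (ipW (schur_operator y) y)) (complex.Re (ipW y y))
    (ipV (K y) (A x)).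
Proof.
rewrite /pencil_form /prod_form /pencil_operator /=.
have := selfadj_formE y saB; move: (schur_operator y) => By ByE.
rewrite !linearZl_LR /= saA !linearDl !linearNl /= !linearZl_LR /=.
rewrite -formE -(formE ipW) -(selfadj_formE x saA) -ByE.
by rewrite (adjoint_sym adjK) -form_conj (saA x x).
Qed.

Lemma pencil_operator_bounded l s t :
  bounded_operator (prod_form ipV ipW) (prod_form ipV ipW)
    (pencil_operator l s t).
Proof.
have b1 := bounded_fst hilbV hilbW; have b2 := bounded_snd hilbV hilbW.
apply: bounded_pair => //=; apply: bounded_scale => //.
  apply: (bounded_comp bddA); apply: bounded_add => //.
    apply: bounded_add => //; first exact: bounded_scale.
    by apply: bounded_opp => //; exact: (bounded_comp bddA b1).
  exact: (bounded_comp bddK b2).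
apply: bounded_add => //.
  apply: bounded_add => //; first exact: (bounded_comp bddB b2).
  by apply: bounded_opp => //; exact: bounded_scale.
apply: bounded_scale => //; apply: (bounded_comp bddK').
exact: (bounded_comp bddA b1).
Qed.

(** With G the inverse of the pencil operator, the inverse of S - l sends (g,
    h) to (A z, y), where (z, y) = G (- s g, t (h - K^* g)). *)
Lemma separated_invertible de l :
  (forall y, de * complex.Re (ipW y y) <=
    complex.Re (ipW (schur_operator y) y)) ->
  separated kap am ap bm de l ->
  boundedly_invertible (prod_form ipV ipW) (fun u => block_operator u - l *: u).
Proof.
move=> hde [s [t [c [s0 t0 c0 hsep]]]].
have hilb := prod_form_hilbert hilbV hilbW.
have posVW := hilb.1.
have [m m0 hm] : exists2 m, 0 < m & forall x,
    complex.Re (ipV x x) <= m * complex.Re (ipV (A x) (A x)).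
  by case: upA => _ _ _; exact: invertible_bounded_below.
have coer u : c / (m + 1) * complex.Re (prod_form ipV ipW u u) <=
    complex.Re (prod_form ipV ipW (pencil_operator l s t u) u).
  case: u => x y; rewrite pencil_formE.
  apply: le_trans (hsep _ _ _ _ _ (block_values_of x y hde)).
  rewrite -mulrA ler_pM2l// ler_pdivrMl ?addr_gt0// Re_prod_form /=.
  have := hm x; have := Re_form_ge0 posW y; have := Re_form_ge0 posV (A x).
  move: (complex.Re _) (complex.Re _) (complex.Re _) => P Q N hP hQ hN.
  have : 0 <= m * Q by rewrite mulr_ge0// ltW.
  lra.
have [M _ hM] := bounded_sqr posVW posVW (pencil_operator_bounded l s t).
have cm0 : 0 < c / (m + 1) by rewrite divr_gt0// addr_gt0.
have [G [GK KG bddG]] := coercive_invertible hilb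
  (pencil_operatorB l s t) cm0 hM coer.
have [Ai [AiK KAi _]] : boundedly_invertible ipV A by case: upA.
pose rhs (gh : V * W) := (- (s *: gh.1), t *: (gh.2 - K' gh.1)).
exists (fun gh => (A (G (rhs gh)).1, (G (rhs gh)).2)); split.
- move=> [x y].
  have -> : block_operator (x, y) - l *: (x, y) =
      (A x - A (K y) - l *: x, K' (A x) + D y - l *: y) by [].
  set gh := (_ - l *: x, _).
  change ((A (G (rhs gh)).1, (G (rhs gh)).2) = (x, y)).
  suff -> : rhs gh = pencil_operator l s t (Ai x, y) by rewrite GK /= KAi.
  rewrite /rhs /gh /pencil_operator /= KAi; congr pair.
    rewrite -scalerN; congr (_ *: _).
    rewrite (linearD A) (linearB A) (linearZ_LR A) /= KAi !opprB.
    by rewrite addrA addrAC.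
  congr (_ *: _); rewrite !(linearB K') (linearZ_LR K') /= /schur_operator.
  rewrite !opprB !addrA.
  by rewrite [LHS](ACl ((2*5*3*4)*(1*6))) /= subrr addr0.
- move=> [g h]; set w := G _.
  have E : pencil_operator l s t w = rhs (g, h) by rewrite KG.
  case: w E => z y E.
  have e1 : A (l *: z - A z + K y) = - g.
    by apply: (scalerI s0); rewrite scalerN; exact: (congr1 fst E).
  have e2 : schur_operator y - l *: y + l *: K' (A z) = h - K' g.
    by apply: (scalerI t0); exact: (congr1 snd E).
  have e3 : A (A z) = g + l *: A z + A (K y).
    rewrite -[g]opprK -e1 (linearD A) (linearB A) (linearZ_LR A) /= opprD opprB.
    by rewrite (addrAC _ (- A (K y))) subrK subrK.
  have -> : forall u v, block_operator (u, v) - l *: (u, v) =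
      (A u - A (K v) - l *: u, K' (A u) + D v - l *: v) by [].
  congr pair; first by rewrite e3 addrK addrK.
  rewrite e3 !(linearD K') (linearZ_LR K') /= -[h](subrK (K' g)) -e2.
  rewrite /schur_operator.
  by rewrite [LHS](ACl (4*3*5*2*1)).
- have b1 := bounded_fst hilbV hilbW; have b2 := bounded_snd hilbV hilbW.
  have bddr : bounded_operator (prod_form ipV ipW) (prod_form ipV ipW) rhs.
    apply: bounded_pair => //=.
      by apply: bounded_opp => //; exact: bounded_scale.
    apply: bounded_scale => //; apply: bounded_add => //.
    by apply: bounded_opp => //; exact: (bounded_comp bddK' b1).
  have bGr := bounded_comp bddG bddr.
  apply: bounded_pair => //=; last exact: (bounded_comp b2 bGr).
  by apply: (bounded_comp bddA); exact: (bounded_comp b1 bGr).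
Qed.

(** <AKz, y> and <K^*Ay, z> are complex conjugates, so they cancel in the real
    part of <Su, u>, which is therefore <Ay, y> + <Dz, z>. *)
Lemma invertible_right_of_diagonal (dp x : R) :
  bounded_operator ipW ipW D ->
  (forall y, complex.Re (ipW (D y) y) <= dp * complex.Re (ipW y y)) ->
  Num.max ap dp < x ->
  boundedly_invertible (prod_form ipV ipW)
    (fun u => block_operator u - x%:C *: u).
Proof.
move=> bddD D_le xlt.
have hilb := prod_form_hilbert hilbV hilbW.
have b1 := bounded_fst hilbV hilbW; have b2 := bounded_snd hilbV hilbW.
have bA := bounded_comp bddA b1.
have bAK := bounded_comp bddA (bounded_comp bddK b2).
have bblk : bounded_operator (prod_form ipV ipW) (prod_form ipV ipW)
    (fun u => - (block_operator u - x%:C *: u)).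
  apply: (bounded_opp hilb.1); apply: (bounded_add hilb.1); last first.
    apply: (bounded_opp hilb.1); apply: (bounded_scale _ hilb.1).
    exact: bounded_id.
  apply: (bounded_pair hilbV hilbW) => /=.
    by apply: bounded_add => //; exact: bounded_opp.
  apply: bounded_add => //; first exact: (bounded_comp bddK' bA).
  exact: (bounded_comp bddD b2).
have [M _ hM] := bounded_sqr hilb.1 hilb.1 bblk.
apply: (boundedly_invertible_opp hilb.1).
apply: (coercive_invertible hilb _ _ hM (c := x - Num.max ap dp)).
- have blkB u v : block_operator (u - v) = block_operator u - block_operator v.
    rewrite /block_operator /= (raddfB A) (raddfB K) (raddfB A (K u.2)).
    rewrite (raddfB K') (raddfB D).
    congr pair.
      by rewrite /= !opprD !opprK [LHS]addrACA.
    by rewrite /= opprD [LHS]addrACA.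
  by move=> u v; rewrite blkB scalerBr !opprD !opprK [LHS]addrACA.
- by rewrite subr_gt0.
- move=> [y z]; rewrite linearNl (linearBl (prod_form ipV ipW)) linearZl_LR /=.
  rewrite /prod_form /= (linearBl ipV) (linearDl ipW) /=.
  have := A_le y; have := D_le z; have := Re_formC ipV (A y) (K z).
  rewrite (saA (K z)) (adjoint_sym adjK).
  have : ap * complex.Re (ipV y y) <= Num.max ap dp * complex.Re (ipV y y).
    by rewrite ler_wpM2r ?Re_form_ge0// le_max lexx.
  have : dp * complex.Re (ipW z z) <= Num.max ap dp * complex.Re (ipW z z).
    by rewrite ler_wpM2r ?Re_form_ge0// le_max lexx orbT.
  case: (ipV y y) (ipW z z) (ipV (A y) y) (ipW (D z) z) (ipV (K z) (A y))
    (ipV (A y) (K z)) => p p' [q q'] [a a'] [d d'] [k k'] [j j'].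
  simpc; rewrite /=; lra.
Qed.

End BlockOperator.

(** * From numerical ranges to the spectrum *)

Section NumericalRange.
Set Implicit Arguments.
Unset Strict Implicit.
Context {R : realType} {V : lmodType R[i]} (ip : hermitian_form V).
Hypothesis pos : positive_definite_form ip.

Lemma numerical_range_bounds (T : V -> V) (a b : R) : linear T ->
  closure (numerical_range ip T) = complex_segment a b ->
  forall x, a * complex.Re (ip x x) <= complex.Re (ip (T x) x) /\
            complex.Re (ip (T x) x) <= b * complex.Re (ip x x).
Proof.
move=> Tlin hcl x; have [->|x0] := eqVneq x 0.
  by rewrite !linear0r /=; split; lra.
have n0 : 0 < complex.Re (ip x x).
  by rewrite ltNge; apply: contra_neqN x0 => /(Re_form_eq0 pos).
pose r := (ipnorm ip x)^-1.
have r2 : r ^+ 2 * complex.Re (ip x x) = 1.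
  by rewrite /r exprVn ipnorm_sqr// mulVf ?gt_eqF.
pose g := r%:C *: x.
have Tg : T g = r%:C *: T x.
  exact: (GRing.scalable_linear Tlin).
have : complex_segment a b (ip (T g) g).
  rewrite -hcl; apply: subset_closure; exists g => //=.
  apply/eqP; rewrite -(eqrXn2 (n := 2)) ?sqrtr_ge0// ipnorm_sqr// expr1n.
  by rewrite /g Re_formZ /= expr0n addr0 r2.
rewrite Tg /g linearZl_LR linearZr_LR /= => -[y /=]; rewrite in_itv /=.
move=> /andP[ay yb].
case: (ip (T x) x) => p p'; simpc => -[e _] /=; move: ay yb.
rewrite {}e mulrA -expr2; move: (complex.Re _) n0 r2 => n n0 r2.
move=> h1 h2; have pE : r ^+ 2 * p * n = p by rewrite mulrAC r2 mul1r.
by split; rewrite -pE ler_pM2r.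
Qed.

End NumericalRange.

Section OperatorNorm.
Set Implicit Arguments.
Unset Strict Implicit.
Context {R : realType} {V W : lmodType R[i]} (ipV : hermitian_form V)
  (ipW : hermitian_form W) (T : {linear V -> W}).
Hypothesis posV : positive_definite_form ipV.
Hypothesis posW : positive_definite_form ipW.
Hypothesis bddT : bounded_operator ipV ipW T.

Let ipnormZ (U : lmodType R[i]) (ip : hermitian_form U) (r : R) x :
  positive_definite_form ip -> 0 <= r ->
  ipnorm ip (r%:C *: x) = r * ipnorm ip x.
Proof.
move=> pos r0; apply/eqP; rewrite -(eqrXn2 (n := 2)) ?mulr_ge0 ?sqrtr_ge0//.
by rewrite exprMn !ipnorm_sqr// Re_formZ /= expr0n addr0.
Qed.

Let norm_set := [set ipnorm ipW (T x) | x in [set x | ipnorm ipV x <= 1]].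

Let norm_set0 : norm_set 0.
Proof. by exists 0; rewrite /= ?linear0 /ipnorm linear0l /= sqrtr0. Qed.

Let norm_set_sup : has_sup norm_set.
Proof.
split; first by exists 0.
case: bddT => M hM; exists `|M| => _ [x /= x1 <-].
apply: le_trans (hM x) _; apply: (@le_trans _ _ (`|M| * ipnorm ipV x)).
  by rewrite ler_wpM2r ?sqrtr_ge0 ?ler_norm.
by rewrite ler_piMr.
Qed.

Lemma operator_norm_ge0 : 0 <= operator_norm ipV ipW T.
Proof. by apply: sup_upper_bound. Qed.

Lemma operator_norm_le x :
  ipnorm ipW (T x) <= operator_norm ipV ipW T * ipnorm ipV x.
Proof.
have [->|x0] := eqVneq x 0.
  by rewrite linear0 /ipnorm !linear0l /= sqrtr0 mulr0.
have n0 : 0 < ipnorm ipV x.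
  rewrite lt_def sqrtr_ge0 andbT; apply: contra_neqN x0 => /eqP n0.
  by apply: (Re_form_eq0 posV); rewrite -ipnorm_sqr// n0 expr0n.
rewrite -ler_pdivrMr// mulrC -ipnormZ// ?invr_ge0 ?(ltW n0)//.
rewrite -linearZ; apply: sup_upper_bound => //.
exists ((ipnorm ipV x)^-1%:C *: x) => //=.
by rewrite ipnormZ ?invr_ge0 ?(ltW n0)// mulVf ?gt_eqF.
Qed.

End OperatorNorm.

Section BlockSpectrum.
Set Implicit Arguments.
Unset Strict Implicit.

(** Stated for an isometric copy H of V * W under phi, so that it applies to
    both orders of the components of a fundamental decomposition. If V or W is
    trivial, its numerical ranges are empty and their endpoints are arbitrary
    numbers; the inequalities of [numerical_range_bounds], from which
    everything follows, hold there too. *)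
Theorem block_spectrum (R : realType) (V W H : lmodType R[i])
    (ipV : hermitian_form V) (ipW : hermitian_form W) (ipH : hermitian_form H)
    (phi : V * W -> H) (psi : H -> V * W) (S : H -> H)
    (A : {linear V -> V}) (K : {linear W -> V}) (K' : {linear V -> W})
    (D : {linear W -> W}) (kap am ap dm dp bm bp : R) :
  hilbert_space ipV -> hilbert_space ipW ->
  linear phi -> cancel phi psi -> cancel psi phi ->
  (forall u, ipnorm ipH (phi u) = ipnorm (prod_form ipV ipW) u) ->
  (forall u, S (phi u) = phi (block_operator A K K' D u)) ->
  is_adjoint ipW ipV K K' ->
  uniformly_positive_operator ipV A ->
  0 <= kap -> kap < 1 ->
  (forall y, ipnorm ipV (K y) <= kap * ipnorm ipW y) ->
  bounded_operator ipW ipW D ->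
  uniformly_positive_operator ipW (fun y => D y + K' (A (K y))) ->
  closure (numerical_range ipV A) = complex_segment am ap ->
  closure (numerical_range ipW D) = complex_segment dm dp ->
  closure (numerical_range ipW (fun y => D y + K' (A (K y)))) =
    complex_segment bm bp ->
  spectrum ipH S `\` @real_line R `<=`
    [set l | `|l - ap%:C| < ap%:C /\ bm / 2 < complex.Re l] /\
  spectrum ipH S `&` @real_line R `<=`
    complex_segment (Num.min am bm) (Num.max ap dp).
Proof.
move=> hilbV hilbW phi_lin phiK psiK iso Sphi adjK upA kap0 kap1 K_le bddD upB.
move=> rangeA rangeD rangeB.
have [posV _] := hilbV; have [posW _] := hilbW.
have Alin : linear A := linearP A.
have Dlin : linear D := linearP D.
have Blin := @schur_linear R V W A K K' D.
have A_ge x := (numerical_range_bounds posV Alin rangeA x).1.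
have A_le x := (numerical_range_bounds posV Alin rangeA x).2.
have D_le y := (numerical_range_bounds posW Dlin rangeD y).2.
have B_ge y := (numerical_range_bounds posW Blin rangeB y).1.
have [de de0 B_coer] := uniformly_positive_coercive posW Blin upB.
have not_inv l : spectrum ipH S l -> ~ boundedly_invertible
    (prod_form ipV ipW) (fun u => block_operator A K K' D u - l *: u).
  move=> Sl inv; apply: Sl.
  apply: boundedly_invertible_isometry iso _ inv => //.
  move=> u; rewrite Sphi addrC -scaleNr -phi_lin.
  by rewrite scaleNr addrC.
have not_sep l : spectrum ipH S l -> ~ separated kap am ap bm de l.
  move=> /not_inv ninv sep; apply: ninv.
  by apply: separated_invertible B_coer sep.
split=> l [Sl].
  move=> l_nonreal; have v0 : complex.Im l != 0.
    apply: contra_notN l_nonreal => /eqP v0; exists (complex.Re l) => //.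
    by case: l v0 {Sl} => u v /= ->.
  split; last first.
    rewrite ltNge; apply/negP => hl; apply: (not_sep _ Sl).
    apply: separated_half_plane (ltW de0) v0 _ => //.
    by rewrite -ler_pdivlMl// mulrC.
  rewrite normc_def ltcR ltNge; apply/negP => hl; apply: (not_sep _ Sl).
  apply: separated_disc => // u0.
  case: l hl u0 {v0 Sl l_nonreal} => u v /=; rewrite oppr0 addr0 => hl u0.
  (* ap < 0 occurs only if V is trivial. *)
  have [ap0|ap0] := leP 0 ap; last first.
    rewrite (@le_trans _ _ 0) ?addr_ge0 ?sqr_ge0// mulr_ge0_le0 ?(ltW ap0)//.
    by rewrite mulr_ge0// ltW.
  move: hl; rewrite -ler_sqr ?nnegrE ?sqrtr_ge0//.
  rewrite sqr_sqrtr ?addr_ge0 ?sqr_ge0//.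
  lra.
move=> [x _ lE]; subst l; exists x => //=; rewrite in_itv /=; apply/andP; split.
  rewrite leNgt lt_min; apply/negP => /andP[xa xb]; apply: (not_sep _ Sl).
  exact: separated_real.
rewrite leNgt; apply/negP => xlt; apply: (not_inv _ Sl).
exact: (invertible_right_of_diagonal hilbV hilbW adjK upA kap0 K_le A_le bddD
  D_le xlt).
Qed.

End BlockSpectrum.

Theorem theorem5p1 (R : realType) (H : lmodType R[i]) (f : hermitian_form H)
    (S : {linear H -> H}) (krein_H : krein_space f)
    (J_frame_S : J_frame_operator f S) :
  (forall (E : fundamental_decomposition f)
      (A : {linear Hplus E -> Hplus E}) (K : {linear Hminus E -> Hplus E})
      (Kadj : {linear Hplus E -> Hminus E})
      (D : {linear Hminus E -> Hminus E})
      (a_minus a_plus d_minus d_plus b_minus b_plus : R),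
    is_adjoint (ip_minus E) (ip_plus E) K Kadj ->
    has_block_matrix S A (fun x => - A (K x)) (fun x => Kadj (A x)) D ->
    uniformly_positive_operator (ip_plus E) A ->
    bounded_operator (ip_minus E) (ip_plus E) K ->
    operator_norm (ip_minus E) (ip_plus E) K < 1 ->
    bounded_operator (ip_minus E) (ip_minus E) D ->
    self_adjoint (ip_minus E) D ->
    uniformly_positive_operator (ip_minus E)
      (fun x => D x + Kadj (A (K x))) ->
    closure (numerical_range (ip_plus E) A) =
      complex_segment a_minus a_plus ->
    closure (numerical_range (ip_minus E) D) =
      complex_segment d_minus d_plus ->
    closure (numerical_range (ip_minus E) (fun x => D x + Kadj (A (K x)))) =
      complex_segment b_minus b_plus ->
    spectrum (hilbert_ip E) S `\` real_line `<=`
      [set l | `|l - a_plus%:C| < a_plus%:C /\ b_minus / 2 < complex.Re l] /\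
    spectrum (hilbert_ip E) S `&` real_line `<=`
      complex_segment (Num.min a_minus b_minus) (Num.max a_plus d_plus))
  /\
  (forall (E : fundamental_decomposition f)
      (A' : {linear Hplus E -> Hplus E}) (L : {linear Hminus E -> Hplus E})
      (Ladj : {linear Hplus E -> Hminus E})
      (D' : {linear Hminus E -> Hminus E})
      (a'_minus a'_plus d'_minus d'_plus b'_minus b'_plus : R),
    is_adjoint (ip_minus E) (ip_plus E) L Ladj ->
    has_block_matrix S A' (fun x => L (D' x)) (fun x => - D' (Ladj x)) D' ->
    bounded_operator (ip_plus E) (ip_plus E) A' ->
    self_adjoint (ip_plus E) A' ->
    uniformly_positive_operator (ip_plus E)
      (fun x => A' x + L (D' (Ladj x))) ->
    bounded_operator (ip_minus E) (ip_plus E) L ->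
    operator_norm (ip_minus E) (ip_plus E) L < 1 ->
    uniformly_positive_operator (ip_minus E) D' ->
    closure (numerical_range (ip_plus E) A') =
      complex_segment a'_minus a'_plus ->
    closure (numerical_range (ip_minus E) D') =
      complex_segment d'_minus d'_plus ->
    closure (numerical_range (ip_plus E) (fun x => A' x + L (D' (Ladj x)))) =
      complex_segment b'_minus b'_plus ->
    spectrum (hilbert_ip E) S `\` real_line `<=`
      [set l | `|l - d'_plus%:C| < d'_plus%:C /\ b'_minus / 2 < complex.Re l] /\
    spectrum (hilbert_ip E) S `&` real_line `<=`
      complex_segment (Num.min d'_minus b'_minus) (Num.max a'_plus d'_plus)).
Proof.
have decomp_iso (E : fundamental_decomposition f) xp xm :
    ipnorm (hilbert_ip E) (val xp + val xm) =
    ipnorm (prod_form (ip_plus E) (ip_minus E)) (xp, xm).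
  have [ep em] := projP (erefl (val xp + val xm)).
  by rewrite /ipnorm /= /hilbert_ip ep em.
split=> E.
- move=> A K K' D am ap dm dp bm bp adjK SE upA bddK K1 bddD saD upB rA rD rB.
  have posV := (fd_plus_hilbert E).1; have posW := (fd_minus_hilbert E).1.
  apply: (@block_spectrum _ _ _ _ (ip_plus E) (ip_minus E) _
    (fun u => val u.1 + val u.2) (fun x => (proj_plus E x, proj_minus E x))
    S A K K' D (operator_norm (ip_minus E) (ip_plus E) K)) rD rB => //.
  + exact: fd_plus_hilbert.
  + exact: fd_minus_hilbert.
  + move=> a [xp xm] [yp ym].
    transitivity (val (a *: xp + yp) + val (a *: xm + ym)) => //.
    by rewrite !linearP scalerDr addrACA.
  + by move=> [xp xm] /=; have [-> ->] := projP (erefl (val xp + val xm)).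
  + by move=> x; rewrite -proj_sum.
  + by move=> [xp xm]; exact: decomp_iso.
  + by move=> [xp xm]; rewrite SE.
  + exact: operator_norm_ge0.
  + exact: operator_norm_le.
- move=> A L L' D am ap dm dp bm bp adjL SE bddA saA upB bddL L1 upD rA rD rB.
  have posV := (fd_plus_hilbert E).1; have posW := (fd_minus_hilbert E).1.
  have kap0 := operator_norm_ge0 bddL.
  rewrite [Num.max _ _]maxC.
  apply: (@block_spectrum _ _ _ _ (ip_minus E) (ip_plus E) _
    (fun u => val u.2 + val u.1) (fun x => (proj_minus E x, proj_plus E x))
    S D L' L A (operator_norm (ip_minus E) (ip_plus E) L)) rA rB => //.
  + exact: fd_minus_hilbert.
  + exact: fd_plus_hilbert.
  + move=> a [xm xp] [ym yp].
    transitivity (val (a *: xp + yp) + val (a *: xm + ym)) => //.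
    by rewrite !linearP scalerDr addrACA.
  + by move=> [xm xp] /=; have [-> ->] := projP (erefl (val xp + val xm)).
  + by move=> x; rewrite -proj_sum.
  + move=> [xm xp]; rewrite decomp_iso.
    by rewrite /ipnorm /= /prod_form addrC.
  + by move=> [xm xp]; rewrite SE (addrC (A xp)) (addrC (- _)).
  + exact: adjoint_sym.
  + by apply: adjoint_norm_le => // y; exact: operator_norm_le.
Qed.
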